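(* Let $n \geq 2$, let $E = \mathbf{C}^n$, let $k \geq 0$ and let $X \leq E$ be a hyperplane (linear subspace of codimension one). Then $$\mathrm{diam}_+^{\mathrm{SL}_n(\mathbf{C})}\bigl(\mathrm{Sym}^k E, \mathrm{Sym}^k X\bigr) = k+1, \qquad \mathsf{R}\bigl(\mathrm{Sym}^k E, \mathrm{Sym}^k X\bigr) = \frac{k+1}{1 + \lceil k/(n-1) \rceil}.$$
   Context: $\mathrm{SL}_n(\mathbf{C})$ acts on $\mathrm{Sym}^k E$ through its natural action on $E$. For a group $H$ acting linearly on a finite-dimensional complex vector space $V$ and a nonzero subspace $U \leq V$, the group-additive diameter is $$\mathrm{diam}_+^{H}(V,U) = \min\{ m \mid g_1\cdot U + \dots + g_m\cdot U = V \text{ for some } g_1,\dots,g_m \in H\},$$ and, when $H$ acts irreducibly, the covering ratio is $\mathsf{R}(V,U) = \mathrm{diam}_+^{H}(V,U) / \lceil \dim V/\dim U\rceil$. *)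

(* Defs.v *)
From HB Require Import structures.
From mathcomp Require Import all_boot all_order all_algebra.
From mathcomp Require Import boolp reals.
From mathcomp Require Import complex.
From mathcomp Require Import mpoly.

Set Implicit Arguments.
Unset Strict Implicit.
Unset Printing Implicit Defensive.

Import Order.TTheory GRing.Theory Num.Theory.

Local Open Scope ring_scope.

Record linrep (F : fieldType) (G : groupType) (V : vectType F) := LinRep {
  repfun :> G -> 'End(V);
  rep1 : repfun 1%g = \1%VF;
  repM : forall g h : G, repfun (g * h)%g = (repfun g \o repfun h)%VF
}.

Section GroupAdditiveDiameter.
Variables (F : fieldType) (G : groupType) (V : vectType F).
Variables (rho : linrep G V) (U : {vspace V}).

Definition translates_cover (m : nat) : Prop :=
  exists g : 'I_m -> G, (\sum_(i < m) (rho (g i) @: U))%VS = fullv.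

(* The value is 0 when no finite sum of translates of U is V. This is not
   ambiguous: a nonzero V is never the sum of zero translates. *)
Definition diam : nat :=
  if pselect (exists m, `[< translates_cover m >]) is left ex_cover
  then ex_minn ex_cover else 0%N.

Definition covering_ratio : rat :=
  diam%:R / (Num.ceil ((\dim {:V})%:R / (\dim U)%:R : rat))%:~R.

Lemma diam_eqP (m : nat) : (0 < m)%N ->
  diam = m <->
  translates_cover m /\ forall m', translates_cover m' -> (m <= m')%N.
Proof.
move=> m_gt0; rewrite /diam; case: pselect => [ex|nex].
  case: ex_minnP => d /asboolP cd dmin; split=> [<-|[cm mmin]].
    by split=> // m' cm'; apply/dmin/asboolP.
  by apply/eqP; rewrite eqn_leq mmin // dmin //; apply/asboolP.
split=> [m0|[cm _]]; first by rewrite -m0 in m_gt0.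
by case: nex; exists m; apply/asboolP.
Qed.

End GroupAdditiveDiameter.

Section SpecialLinear.
Variables (F : fieldType) (n : nat).

Record special_linear := SLMx {
  SLval :> 'M[F]_n;
  _ : \det SLval == 1
}.

HB.instance Definition _ := [isSub for SLval].
HB.instance Definition _ := [Choice of special_linear by <:].

Lemma det_SL (g : special_linear) : \det g = 1.
Proof. by case: g => A /= /eqP. Qed.

Lemma SL_unitmx (g : special_linear) : (g : 'M_n) \in unitmx.
Proof. by rewrite unitmxE det_SL unitr1. Qed.

Fact SL_one_subproof : \det (1%:M : 'M[F]_n) == 1.
Proof. by rewrite det1. Qed.

Fact SL_mul_subproof (g h : special_linear) : \det (g *m h) == 1.
Proof. by rewrite det_mulmx !det_SL mulr1. Qed.

Fact SL_inv_subproof (g : special_linear) : \det (invmx g) == 1.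
Proof. by rewrite det_inv det_SL invr1. Qed.

Definition SL_one := SLMx SL_one_subproof.
Definition SL_mul g h := SLMx (SL_mul_subproof g h).
Definition SL_inv g := SLMx (SL_inv_subproof g).

Fact SL_mulA : associative SL_mul.
Proof. by move=> f g h; apply: val_inj; rewrite /= mulmxA. Qed.
Fact SL_mul1 : left_id SL_one SL_mul.
Proof. by move=> g; apply: val_inj; rewrite /= mul1mx. Qed.
Fact SL_mulr1 : right_id SL_one SL_mul.
Proof. by move=> g; apply: val_inj; rewrite /= mulmx1. Qed.
Fact SL_mulV : left_inverse SL_one SL_inv SL_mul.
Proof. by move=> g; apply: val_inj; rewrite /= mulVmx ?SL_unitmx. Qed.
Fact SL_mulrV : right_inverse SL_one SL_inv SL_mul.
Proof. by move=> g; apply: val_inj; rewrite /= mulmxV ?SL_unitmx. Qed.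

HB.instance Definition _ :=
  isGroup.Build special_linear SL_mulA SL_mul1 SL_mulr1 SL_mulV SL_mulrV.

End SpecialLinear.

(* The library proves finite dimensionality only for a positive number of
   variables. *)
Fact dhomog_vecaxiom_all (F : fieldType) (n k : nat) :
  vector_axiom 'C((k + n).-1, k) (dhomog n F k).
Proof.
case: n => [|m]; last first.
  by have := @dhomog_vecaxiom m F k; rewrite addnS.
rewrite addn0.
have mpolyC0 (p : {mpoly F[0]}) : p = (p@_0)%:MP.
  apply/mpolyP => m; have -> : m = 0%MM by apply/mnmP => -[].
  by rewrite mcoeffC eqxx mulr1.
case: k => [|d].
  have hC (c : F) : c%:MP \is [in F[0], 0.-homog].
    by rewrite -[c%:MP]mulr1 mul_mpolyC; apply/dhomogZ/dhomog1.
  exists (fun p : dhomog 0 F 0 => \row_(i < 1) (p : {mpoly F[0]})@_0).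
    by move=> c p q; apply/rowP => i; rewrite !mxE /= mcoeffD mcoeffZ.
  exists (fun r : 'rV_1 => DHomog (hC (r 0 0))).
    by move=> p; apply: val_inj; rewrite /= mxE -mpolyC0.
  by move=> r; apply/rowP => i; rewrite mxE /= mcoeffC eqxx mulr1 !ord1.
rewrite bin_small //.
exists (fun _ => 0) => [c p q|]; first by rewrite scaler0 addr0.
exists (fun _ => 0) => [p|r]; last by apply/rowP => -[].
apply: val_inj => /=; rewrite [RHS]mpolyC0.
have -> : (p : {mpoly F[0]})@_0 = 0.
  by apply: (dhomog_nemf_coeff (dhomog_is_dhomog p)); rewrite /= mdeg0.
by rewrite rmorph0.
Qed.

(* Sym^k (F^n), as the degree k part of Sym (F^n) = F[X_0, ..., X_(n-1)], where
   X_i stands for the i-th standard basis vector of F^n. *)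
Definition sympow (F : fieldType) (n k : nat) := dhomog n F k.

Lemma prod_homog (F : fieldType) (n l : nat) (d : 'I_l -> nat)
    (p : 'I_l -> {mpoly F[n]}) :
  (forall i, p i \is (d i).-homog) ->
  \prod_i p i \is (\sum_i d i)%N.-homog.
Proof.
move=> hp; elim/big_rec2: _ => [|i q e _ hq]; first exact: dhomog1.
exact: dhomogM.
Qed.

Section SymmetricPower.
Variables (F : fieldType) (n k : nat).

HB.instance Definition _ := GRing.Lmodule.on (sympow F n k).

HB.instance Definition _ :=
  Lmodule_hasFinDim.Build F (sympow F n k) (@dhomog_vecaxiom_all F n k).

Definition linform (v : 'cV[F]_n) : {mpoly F[n]} := \sum_i v i 0 *: 'X_i.

Lemma linform_is_linear : linear linform.
Proof.
move=> c u v; rewrite /linform scaler_sumr -big_split /=.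
by apply: eq_bigr => i _; rewrite !mxE scalerDl scalerA.
Qed.
HB.instance Definition _ :=
  GRing.isLinear.Build F 'cV[F]_n {mpoly F[n]} _ linform linform_is_linear.

Lemma linform_homog (v : 'cV[F]_n) : linform v \is 1.-homog.
Proof.
by apply: rpred_sum => i _; apply: rpredZ; rewrite dhomogX /= mdeg1.
Qed.

Lemma comp_linform (A : 'M[F]_n) (v : 'cV[F]_n) :
  linform v \mPo [tuple linform (col j A) | j < n] = linform (A *m v).
Proof.
have -> : A *m v = \sum_j v j 0 *: col j A.
  apply/colP => i; rewrite mxE summxE; apply: eq_bigr => j _.
  by rewrite !mxE mulrC.
rewrite !linear_sum; apply: eq_bigr => j _ /=.
by rewrite comp_mpolyZ comp_mpolyXU -tnth_nth tnth_mktuple linearZ.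
Qed.

Fact symprod_subproof (x : 'I_k -> 'cV[F]_n) :
  \prod_i linform (x i) \is k.-homog.
Proof.
rewrite -[k in k.-homog]card_ord -sum1_card.
by apply: prod_homog => i; apply: linform_homog.
Qed.

(* The product x_0 ... x_(k-1) in Sym^k (F^n). *)
Definition symprod (x : 'I_k -> 'cV[F]_n) : sympow F n k :=
  DHomog (symprod_subproof x).

Fact symmx_subproof (A : 'M[F]_n) (p : sympow F n k) :
  p \mPo [tuple linform (col j A) | j < n] \is k.-homog.
Proof.
rewrite comp_mpolyEX big_seq; apply: rpred_sum => m m_p.
apply: rpredZ; rewrite comp_mpolyX.
have /dhomogP/(_ m m_p) <- := dhomog_is_dhomog p.
rewrite /= mdegE; apply: prod_homog => i; rewrite tnth_mktuple.
by have := dhomogMn (m i) (linform_homog (col i A)); rewrite mul1n.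
Qed.

(* Sym^k A : the substitution of A e_j for the variable e_j. *)
Definition symmx_fun (A : 'M[F]_n) (p : sympow F n k) : sympow F n k :=
  DHomog (symmx_subproof A p).

Fact symmx_is_linear (A : 'M[F]_n) : linear (symmx_fun A).
Proof. by move=> c p q; apply: val_inj; rewrite /= linearP. Qed.
HB.instance Definition _ (A : 'M[F]_n) :=
  GRing.isLinear.Build F (sympow F n k) (sympow F n k) _ (symmx_fun A)
    (symmx_is_linear A).

Definition symmx (A : 'M[F]_n) : 'End(sympow F n k) := linfun (symmx_fun A).

Lemma symmx_prod (A : 'M[F]_n) (x : 'I_k -> 'cV[F]_n) :
  symmx A (symprod x) = symprod (fun i => A *m x i).
Proof.
rewrite lfunE; apply: val_inj; rewrite /= rmorph_prod.
by apply: eq_bigr => i _; rewrite /= comp_linform.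
Qed.

Lemma symmx1 : symmx 1%:M = \1%VF.
Proof.
apply/lfunP => p; rewrite !lfunE; apply: val_inj; rewrite /=.
rewrite -[RHS]comp_mpoly_id; congr (_ \mPo _).
apply: eq_from_tnth => i; rewrite !tnth_mktuple /linform (bigD1 i) //= big1.
  by rewrite addr0 !mxE eqxx scale1r.
by move=> j /negbTE ji; rewrite !mxE ji scale0r.
Qed.

Lemma symmxM (A B : 'M[F]_n) : symmx (A *m B) = (symmx A \o symmx B)%VF.
Proof.
apply/lfunP => p; rewrite lfunE [RHS]lfunE /= lfunE lfunE; apply: val_inj => /=.
rewrite [p \mPo [tuple linform (col j B) | j < n]]comp_mpolyEX.
rewrite comp_mpolyEX linear_sum; apply: eq_bigr => m _ /=.
rewrite comp_mpolyZ !comp_mpolyX rmorph_prod; congr (_ *: _).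
apply: eq_bigr => i _; rewrite !tnth_mktuple rmorphXn /=; congr (_ ^+ _).
rewrite comp_linform; congr linform; apply/colP => j; rewrite !mxE.
by apply: eq_bigr => l _; rewrite !mxE.
Qed.

(* The copy of Sym^k X inside Sym^k (F^n): the span of the products of k vectors
   of X. To have a finite family, the factors are taken in a basis of X; see
   sympow_sub_prod and sympow_sub_min. *)
Definition sympow_sub (X : {vspace 'cV[F]_n}) : {vspace sympow F n k} :=
  <<[seq symprod (fun i => (vbasis X)`_(f i)) | f : {ffun 'I_k -> 'I_(\dim X)}]>>%VS.

Lemma sympow_sub_prod (X : {vspace 'cV[F]_n}) (x : 'I_k -> 'cV[F]_n) :
  (forall i, x i \in X) -> symprod x \in sympow_sub X.
Proof.
move=> xX.
have -> : symprod x = \sum_(f : {ffun 'I_k -> 'I_(\dim X)})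
    (\prod_i coord (vbasis X) (f i) (x i)) *:
      symprod (fun i => (vbasis X)`_(f i)).
  apply: val_inj; rewrite /= linear_sum /=.
  under eq_bigr => i _ do rewrite {1}(coord_vbasis (xX i)) linear_sum.
  rewrite bigA_distr_bigA /=; apply: eq_bigr => f _.
  under eq_bigr => i _ do rewrite linearZ /=.
  by rewrite scaler_prod.
apply: rpred_sum => f _; apply: rpredZ; apply: memv_span.
by apply/imageP; exists f.
Qed.

Lemma sympow_sub_min (X : {vspace 'cV[F]_n}) (W : {vspace sympow F n k}) :
  (forall x : 'I_k -> 'cV[F]_n, (forall i, x i \in X) -> symprod x \in W) ->
  (sympow_sub X <= W)%VS.
Proof.
move=> WX; apply/span_subvP => _ /imageP[f _ ->]; apply: WX => i.
by apply: vbasis_mem; rewrite mem_nth // size_tuple.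
Qed.

End SymmetricPower.

Definition SL_sympow (F : fieldType) (n k : nat) :
    linrep (special_linear F n) (sympow F n k) :=
  LinRep (repfun := fun g : special_linear F n => symmx k g) (symmx1 F n k)
    (fun g h => symmxM k g h).

(* Main.v *)
From HB Require Import structures.
Require Import Defs.
From mathcomp Require Import all_boot all_order all_algebra.
From mathcomp Require Import reals complex mpoly ring.

Import Order.TTheory GRing.Theory Num.Theory.

Local Open Scope ring_scope.

Set Implicit Arguments.
Unset Strict Implicit.

(** Everything holds over a field F of characteristic 0. Write E for F^n and
    regard Sym^k E as the forms of degree k in n variables, so that the
    directional derivative along a linear functional l on E maps the vector v,
    seen as a linear form, to the constant l v.

    At least k + 1 translates are needed. A translate of X is the kernel of a
    nonzero functional l_i, and the derivative along l_i is a derivation that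
    kills all products of vectors of that kernel, hence the whole translate of
    Sym^k X. Directional derivatives commute, so the composite along
    l_0, ..., l_(m-1) kills the sum of the m translates. But F is infinite, so
    some v in E lies in none of the kernels ([common_nonzero]), and for m <= k the
    composite maps v^k to k (k-1) ... (k-m+1) l_0(v) ... l_(m-1)(v) v^(k-m),
    which is not zero ([dirdersXn]). This is [translates_cover_gt].

    Conversely k + 1 well chosen translates suffice ([transvections_cover]). Take
    a basis of E consisting of a basis of X and one more vector w, let y be one of
    the basis vectors in X (there is one since n > 1), and let g_t be the
    transvection that sends y to y + t w and fixes the other basis vectors. Then
    g_t X contains y + t w and the basis vectors other than y and w. So
    if r is a product of k - a of these other vectors, (y + t w)^a r lies in
    g_t Sym^k X. By the Vandermonde determinant, the powers (y + t w)^a for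
    t = 0, ..., a span all y^b w^j with b + j = a ([monomial_sum_powers]), and
    a <= k, so the translates by g_0, ..., g_k contain every monomial in the
    chosen basis.

    For the ratio, a basis of X embeds F^(dim X) in E as a retract, so the
    functor Sym^k identifies Sym^k X with Sym^k F^(dim X), whose dimension is a
    binomial coefficient ([dim_sympow_sub]); the quotient of dimensions is then
    1 + k / (n - 1). *)

(** * Generators of symmetric powers *)

Section Generation.
Variables (F : fieldType) (n k : nat).

Lemma linform_delta (j : 'I_n) : linform (delta_mx j 0) = 'X_j :> {mpoly F[n]}.
Proof.
rewrite /linform (bigD1 j) //= big1 => [|i /negbTE ij].
  by rewrite addr0 mxE !eqxx scale1r.
by rewrite mxE ij scale0r.
Qed.

(** The factors of the product list each index i with its multiplicity m i. *)
Lemma monomial_symprod (m : 'X_{1..n}) : mdeg m = k ->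
  exists f : 'I_k -> 'I_n,
    'X_[m] = symprod (fun i => delta_mx (f i) 0) :> {mpoly F[n]}.
Proof.
pose s := flatten [seq nseq (m i) i | i <- enum 'I_n].
have s_size : size s = mdeg m.
  rewrite size_flatten /shape -map_comp mdegE sumnE big_map big_enum /=.
  by apply: eq_bigr => i _; rewrite size_nseq.
move=> m_k; have s_k : size s == k by rewrite s_size m_k.
exists (tnth (Tuple s_k)) => /=.
under eq_bigr => i _ do rewrite linform_delta.
rewrite -(big_tuple _ _ (Tuple s_k) predT (fun j => 'X_j)) /=.
rewrite big_flatten big_map big_enum mpolyXE_id; apply: eq_bigr => i _.
by rewrite big_nseq -Monoid.iteropE.
Qed.

Lemma symprod_delta_full (W : {vspace sympow F n k}) :
  (forall f : 'I_k -> 'I_n, symprod (fun i => delta_mx (f i) 0) \in W) ->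
  W = fullv.
Proof.
move=> hW; apply/vspaceP => p; rewrite memvf.
have hmon m : m \in msupp p ->
    exists2 q : sympow F n k, q \in W & q = 'X_[m] :> {mpoly F[n]}.
  move=> m_p; have /dhomogP/(_ m m_p) m_k := dhomog_is_dhomog p.
  have [f ->] := monomial_symprod m_k.
  by exists (symprod (fun i => delta_mx (f i) 0)).
suff [q qW ->] : exists2 q : sympow F n k, q \in W & p = q by [].
suff [q qW qE] : exists2 q : sympow F n k, q \in W &
    \sum_(m <- msupp p) p@_m *: 'X_[m] = q :> {mpoly F[n]}.
  by exists q => //; apply: val_inj; rewrite /= [LHS]mpolyE qE.
rewrite big_seq; elim/big_ind: _ => [|_ _ [q qW ->] [r rW ->]|m /hmon[q qW <-]].
- by exists 0; rewrite ?mem0v.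
- by exists (q + r); rewrite ?memvD.
by exists (p@_m *: q); rewrite ?memvZ.
Qed.

(** The columns of P are an arbitrary basis; the case of the standard basis is
    transported by the automorphism Sym^k P. *)
Lemma symprod_basis_full (P : 'M[F]_n) (W : {vspace sympow F n k}) :
  P \in unitmx ->
  (forall f : 'I_k -> 'I_n, symprod (fun i => P *m delta_mx (f i) 0) \in W) ->
  W = fullv.
Proof.
move=> P_unit hW.
have WP : (symmx k P @^-1: W)%VS = fullv.
  by apply: symprod_delta_full => f; rewrite -memv_preim symmx_prod.
apply/vspaceP => q; rewrite memvf -[q](id_lfunE q) -symmx1 -(mulmxV P_unit).
by rewrite symmxM comp_lfunE memv_preim WP memvf.
Qed.

End Generation.

Lemma eq_symprod (F : fieldType) (n k : nat) (x y : 'I_k -> 'cV[F]_n) :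
  x =1 y -> symprod x = symprod y.
Proof. by move=> xy; apply: val_inj => /=; apply: eq_bigr => i _; rewrite xy. Qed.

Lemma sympow_sub_eq0 (F : fieldType) (n k : nat) (X : {vspace 'cV[F]_n})
    (V : lmodType F) (phi : sympow F n k -> V) (q : sympow F n k) :
  linear phi ->
  (forall x : 'I_k -> 'cV[F]_n, (forall i, x i \in X) -> phi (symprod x) = 0) ->
  q \in sympow_sub k X -> phi q = 0.
Proof.
move=> phi_lin phiX /coord_span ->.
pose psi : {linear sympow F n k -> V} :=
  HB.pack phi (GRing.isLinear.Build F (sympow F n k) V _ phi phi_lin).
rewrite -[phi]/(psi : _ -> _) linear_sum big1 // => i _.
rewrite linearZ; set r := _`_i.
have /imageP[f _ ->] : r \in
    [seq symprod (fun i => (vbasis X)`_(f i)) | f : {ffun 'I_k -> 'I_(\dim X)}].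
  by rewrite mem_nth // size_tuple.
rewrite /= phiX ?scaler0 // => l.
by apply: vbasis_mem; rewrite mem_nth // size_tuple.
Qed.

(** * Coordinates in a basis, and hyperplanes *)

Section Coordinates.
Variables (F : fieldType) (n d : nat) (b : d.-tuple 'cV[F]_n).

Definition basis_mx : 'M[F]_(n, d) := \matrix_(i, j) b`_j i 0.

Definition coord_mx : 'M[F]_(d, n) :=
  \matrix_(i, j) coord b i (delta_mx j 0).

Lemma coord_mxE (v : 'cV[F]_n) (i : 'I_d) : (coord_mx *m v) i 0 = coord b i v.
Proof.
rewrite {2}(matrix_sum_delta v) linear_sum mxE; apply: eq_bigr => j _.
by rewrite mxE big_ord1 linearZ /= mulrC.
Qed.

Lemma basis_mx_delta (j : 'I_d) : basis_mx *m delta_mx j (0 : 'I_1) = b`_j.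
Proof. by apply/colP => i; rewrite -colE !mxE. Qed.

Lemma coord_basis_mx : free b -> coord_mx *m basis_mx = 1%:M.
Proof.
move=> b_free; apply/matrixP => i j.
have -> : (coord_mx *m basis_mx) i j =
    (coord_mx *m (basis_mx *m delta_mx j (0 : 'I_1))) i 0.
  by rewrite mulmxA -colE [RHS]mxE.
by rewrite basis_mx_delta coord_mxE coord_free // mxE eq_sym.
Qed.

Lemma basis_coord_mx (v : 'cV[F]_n) :
  v \in <<b>>%VS -> basis_mx *m (coord_mx *m v) = v.
Proof.
move=> /coord_span vE; rewrite [RHS]vE.
apply/colP => l; rewrite summxE mxE; apply: eq_bigr => j _.
by rewrite coord_mxE !mxE mulrC.
Qed.

End Coordinates.

(** A basis of X is extended to one of the whole space; i0 is then the index of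
    the added vector. *)
Lemma hyperplane_coord (F : fieldType) (n : nat) (X : {vspace 'cV[F]_n}) :
  (\dim X).+1 = n ->
  exists2 Q : 'M[F]_n, Q \in unitmx &
    exists i0, forall v, (v \in X) = ((Q *m v) i0 0 == 0).
Proof.
set d := \dim X => dn.
have dimV : \dim {:'cV[F]_n} = n by rewrite dimvf dim_matrix mulr1.
have dimC : \dim X^C = 1%N by rewrite dimv_compl dimV -[X in (X - _)%N]dn subSnn.
pose b := cat_tuple (vbasis X) (vbasis X^C).
have b_basis : basis_of fullv b.
  rewrite -(addv_complf X); apply: cat_basis; try exact: vbasisP.
  by apply/directv_addP; rewrite capv_compl.
have [b_full b_free] := andP b_basis.
have szb : size b == n by rewrite size_tuple -/d dimC addn1 dn.
exists (coord_mx (Tuple szb)).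
  by have [] := mulmx1_unit (coord_basis_mx (b := Tuple szb) b_free).
have d_lt : (d < n)%N by rewrite -dn.
exists (Ordinal d_lt) => v; rewrite coord_mxE.
pose c i (u : 'cV[F]_n) := coord (Tuple szb) i u.
have vE : v = \sum_(i < n) c i v *: b`_i.
  by rewrite {1}(coord_basis (X := Tuple szb) b_basis (memvf v)).
have b_X (i : 'I_n) : (i < d)%N -> b`_i \in X.
  move=> i_d; rewrite nth_cat size_tuple i_d.
  by apply: vbasis_mem; rewrite mem_nth // size_tuple.
apply/idP/eqP => [vX|c0]; last first.
  rewrite vE; apply: rpred_sum => i _.
  have := ltn_ord i.
  rewrite -[X in (_ < X)%N]dn ltnS leq_eqVlt => /predU1P[i_d|i_d].
    by rewrite (_ : i = Ordinal d_lt) /c ?c0 ?scale0r ?mem0v //; apply: val_inj.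
  by rewrite memvZ ?b_X.
rewrite (coord_vbasis vX) linear_sum big1 // => j _ /=.
have j_n : (j < n)%N by rewrite (ltn_trans _ d_lt).
have -> : (vbasis X)`_j = (Tuple szb)`_(Ordinal j_n).
  by rewrite /= nth_cat size_tuple ltn_ord.
have c_j : c (Ordinal d_lt) (Tuple szb)`_(Ordinal j_n) = 0.
  by rewrite /c coord_free // -val_eqE /= ltn_eqF.
by rewrite linearZ /= -/(c _ _) c_j mulr0.
Qed.

(** * Functoriality, and the dimension of Sym^k X *)

Section RectangularPower.
Variables (F : fieldType) (k : nat).

Lemma comp_linform_rect (p n : nat) (A : 'M[F]_(p, n)) (v : 'cV[F]_n) :
  linform v \mPo [tuple linform (col j A) | j < n] = linform (A *m v).
Proof.
have -> : A *m v = \sum_j v j 0 *: col j A.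
  apply/colP => i; rewrite mxE summxE; apply: eq_bigr => j _.
  by rewrite !mxE mulrC.
rewrite !linear_sum; apply: eq_bigr => j _ /=.
by rewrite comp_mpolyZ comp_mpolyXU -tnth_nth tnth_mktuple linearZ.
Qed.

Lemma sympow_map_subproof (p n : nat) (A : 'M[F]_(p, n)) (q : sympow F n k) :
  q \mPo [tuple linform (col j A) | j < n] \is k.-homog.
Proof.
rewrite comp_mpolyEX big_seq; apply: rpred_sum => m m_p.
apply: rpredZ; rewrite comp_mpolyX.
have /dhomogP/(_ m m_p) <- := dhomog_is_dhomog q.
rewrite /= mdegE; apply: prod_homog => i; rewrite tnth_mktuple.
by have := dhomogMn (m i) (linform_homog (col i A)); rewrite mul1n.
Qed.

Definition sympow_map_fun (p n : nat) (A : 'M[F]_(p, n)) (q : sympow F n k) :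
  sympow F p k := DHomog (sympow_map_subproof A q).

Lemma sympow_map_is_linear (p n : nat) (A : 'M[F]_(p, n)) :
  linear (sympow_map_fun A).
Proof. by move=> c q r; apply: val_inj; rewrite /= linearP. Qed.
HB.instance Definition _ (p n : nat) (A : 'M[F]_(p, n)) :=
  GRing.isLinear.Build F (sympow F n k) (sympow F p k) _ (sympow_map_fun A)
    (sympow_map_is_linear A).

(** Sym^k A for a rectangular matrix A, which makes Sym^k a functor between spaces
    of different dimensions. *)
Definition sympow_map (p n : nat) (A : 'M[F]_(p, n)) :
  'Hom(sympow F n k, sympow F p k) := linfun (sympow_map_fun A).

Lemma sympow_map_prod (p n : nat) (A : 'M[F]_(p, n)) (x : 'I_k -> 'cV[F]_n) :
  sympow_map A (symprod x) = symprod (fun i => A *m x i).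
Proof.
rewrite lfunE; apply: val_inj; rewrite /= rmorph_prod.
by apply: eq_bigr => i _; rewrite /= comp_linform_rect.
Qed.

Lemma sympow_mapK (p n : nat) (A : 'M[F]_(p, n)) (B : 'M[F]_(n, p)) :
  B *m A = 1%:M -> cancel (sympow_map A) (sympow_map B).
Proof.
move=> BA q.
pose D := (sympow_map B \o sympow_map A - \1)%VF.
have DE r : D r = sympow_map B (sympow_map A r) - r.
  by rewrite add_lfunE opp_lfunE comp_lfunE id_lfunE.
apply/eqP; rewrite -subr_eq0 -DE -memv_ker.
rewrite (@symprod_delta_full _ _ _ (lker D)) ?memvf // => f.
rewrite memv_ker DE !sympow_map_prod subr_eq0; apply/eqP.
by apply: eq_symprod => i; rewrite mulmxA BA mul1mx.
Qed.

(** The map Sym^k F^(dim X) -> Sym^k F^n induced by a basis of X has image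
    Sym^k X, and it is injective because the coordinate matrix, a left inverse of
    the basis matrix, induces a left inverse. *)
Lemma dim_sympow_sub (n : nat) (X : {vspace 'cV[F]_n}) :
  \dim (sympow_sub k X) = 'C((k + \dim X).-1, k).
Proof.
have b_free := basis_free (vbasisP X).
have -> : sympow_sub k X = (sympow_map (basis_mx (vbasis X)) @: fullv)%VS.
  apply/eqP; rewrite eqEsubv; apply/andP; split.
    apply: sympow_sub_min => x xX.
    rewrite (_ : symprod x = sympow_map (basis_mx (vbasis X))
        (symprod (fun i => coord_mx (vbasis X) *m x i))).
      exact/memv_img/memvf.
    rewrite sympow_map_prod; apply: eq_symprod => i.
    by rewrite basis_coord_mx // (span_basis (vbasisP X)).
  rewrite -(@symprod_delta_full _ _ _
      (sympow_map (basis_mx (vbasis X)) @^-1: sympow_sub k X)%VS).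
    by apply/subvP => _ /memv_imgP[q qW ->]; rewrite memv_preim.
  move=> f; rewrite -memv_preim sympow_map_prod.
  apply: sympow_sub_prod => i; rewrite basis_mx_delta.
  by apply: vbasis_mem; rewrite mem_nth // size_tuple.
rewrite limg_dim_eq ?dimvf // (_ : lker _ = 0%VS) ?capv0 //.
exact/eqP/lker0P/(can_inj (sympow_mapK (coord_basis_mx b_free))).
Qed.

End RectangularPower.

(** * Directional derivatives *)

Section DirectionalDerivatives.
Variables (F : fieldType) (n : nat).
Implicit Types (l : 'rV[F]_n) (p q : {mpoly F[n]}) (v : 'cV[F]_n).

Definition dirder l p : {mpoly F[n]} := \sum_j l 0 j *: mderiv j p.

Lemma dirder_is_linear l : linear (dirder l).
Proof.
move=> c p q; rewrite /dirder scaler_sumr -big_split /=.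
by apply: eq_bigr => j _; rewrite linearP scalerDr !scalerA mulrC.
Qed.
HB.instance Definition _ l :=
  GRing.isLinear.Build F {mpoly F[n]} {mpoly F[n]} _ (dirder l)
    (dirder_is_linear l).

Lemma dirderM l p q : dirder l (p * q) = dirder l p * q + p * dirder l q.
Proof.
rewrite /dirder mulr_suml mulr_sumr -big_split /=; apply: eq_bigr => j _.
by rewrite mderivM scalerDr scalerAl scalerAr.
Qed.

Lemma dirder1 l : dirder l 1 = 0.
Proof. by rewrite /dirder big1 // => j _; rewrite -mpolyC1 mderivC scaler0. Qed.

Lemma mderiv_linform v j : mderiv j (linform v) = (v j 0)%:MP.
Proof.
have mderivU i : mderiv j ('X_i : {mpoly F[n]}) = (i == j)%:R%:MP.
  rewrite mderivX mnm1E.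
  case: (i =P j) => [->|_]; last by rewrite scale0r mpolyC0.
  have -> : (U_(j) - U_(j))%MM = 0%MM :> 'X_{1..n}.
    by apply/mnmP => i'; rewrite mnmBE mnm0E subnn.
  by rewrite mpolyX0 alg_mpolyC.
rewrite /linform (raddf_sum (mderiv j)) (bigD1 j) //=.
rewrite [X in _ + X]big1 => [|i /negbTE ij].
  by rewrite addr0 mderivZ mderivU eqxx -mul_mpolyC mulr1.
by rewrite mderivZ mderivU ij mpolyC0 scaler0.
Qed.

Lemma dirder_linform l v : dirder l (linform v) = ((l *m v) 0 0)%:MP.
Proof.
rewrite /dirder mxE rmorph_sum /=; apply: eq_bigr => j _.
by rewrite mderiv_linform -mul_mpolyC -mpolyCM.
Qed.

Lemma dirderC l1 l2 p : dirder l1 (dirder l2 p) = dirder l2 (dirder l1 p).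
Proof.
have mderiv_dirder i : mderiv i (dirder l2 p) = dirder l2 (mderiv i p).
  rewrite {1}/dirder (raddf_sum (mderiv i)); apply: eq_bigr => j _.
  by rewrite /= mderivZ mderiv_comm.
rewrite {1}/dirder [dirder l1 p]/dirder (raddf_sum (dirder l2)).
by apply: eq_bigr => i _; rewrite mderiv_dirder [RHS]linearZ.
Qed.

Lemma dirderXn l v k :
  dirder l (linform v ^+ k.+1) = (k.+1%:R * (l *m v) 0 0) *: linform v ^+ k.
Proof.
elim: k => [|k IH]; first by rewrite expr1 dirder_linform mul1r expr0 alg_mpolyC.
rewrite exprS dirderM dirder_linform IH mul_mpolyC -scalerAr -exprS -scalerDl.
by rewrite -[in RHS]add1n natrD mulrDl mul1r.
Qed.

(** By the Leibniz rule, the derivative along l kills Sym^k of the kernel of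
    l. *)
Lemma dirder_prod k l (x : 'I_k -> 'cV[F]_n) :
  (forall i, (l *m x i) 0 0 = 0) -> dirder l (\prod_i linform (x i)) = 0.
Proof.
move=> lx; elim/big_rec: _ => [|i p _ IH]; first exact: dirder1.
by rewrite dirderM IH dirder_linform lx mpolyC0 mul0r mulr0 addr0.
Qed.

Definition dirders (s : seq 'rV[F]_n) p := foldr dirder p s.

Lemma dirders_is_linear s : linear (dirders s).
Proof. by move=> c p q; elim: s => //= l s ->; rewrite linearP. Qed.
HB.instance Definition _ s :=
  GRing.isLinear.Build F {mpoly F[n]} {mpoly F[n]} _ (dirders s)
    (dirders_is_linear s).

(** Since the derivatives commute, any one of them can be applied first. *)
Lemma dirders_mem0 l s p : l \in s -> dirder l p = 0 -> dirders s p = 0.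
Proof.
have dirdersC r q : dirders r (dirder l q) = dirder l (dirders r q).
  by elim: r => //= a r ->; rewrite dirderC.
move=> /[swap] lp; elim: s => //= a s IH; rewrite inE => /predU1P[<-|/IH->].
  by rewrite -dirdersC lp linear0.
by rewrite linear0.
Qed.

Lemma dirdersXn s v k : (size s <= k)%N ->
  dirders s (linform v ^+ k) =
    ((k ^_ size s)%:R * \prod_(l <- s) (l *m v) 0 0) *: linform v ^+ (k - size s).
Proof.
elim: s => [|l s IH] /= sk; first by rewrite big_nil ffactn0 mulr1 scale1r subn0.
rewrite IH 1?ltnW // linearZ /= big_cons -[in LHS](@subnSK _ k) //.
rewrite dirderXn scalerA ffactnSr natrM subnSK //; congr (_ *: _).
by rewrite mulrACA [X in _ = _ * X]mulrC -!mulrA.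
Qed.

Lemma linform_inj : injective (@linform F n).
Proof.
move=> u v uv; apply/colP => i; have := congr1 (mcoeff U_(i)) uv.
have coefE w : (linform w)@_U_(i) = w i 0 :> F.
  rewrite /linform linear_sum (bigD1 i) //= big1 => [|j /negbTE ji].
    by rewrite addr0 mcoeffZ mcoeffXU eqxx mulr1.
  by rewrite mcoeffZ mcoeffXU ji mulr0.
by rewrite !coefE.
Qed.

End DirectionalDerivatives.

(** * Consequences of characteristic 0 *)

Lemma pchar0_natr_inj (F : fieldType) :
  has_pchar0 F -> injective (fun i : nat => i%:R : F).
Proof.
move=> /pcharf0P F0 i j /eqP; wlog ij : i j / (i <= j)%N => [hw|].
  by case/orP: (leq_total i j) => /hw // h /eqP/esym/eqP/h.
rewrite eq_sym -subr_eq0 -natrB // F0 subn_eq0 => ji.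
by apply/eqP; rewrite eqn_leq ij.
Qed.

Lemma pchar0_nonroot (F : fieldType) (p : {poly F}) :
  has_pchar0 F -> p != 0 -> exists t, ~~ root p t.
Proof.
move=> F0 p0; pose s := [seq i%:R : F | i <- iota 0 (size p)].
have /allPn[t _ t_p] : ~~ all (root p) s.
  apply: contraL (leqnn (size p)) => /(max_poly_roots p0).
  rewrite (map_inj_uniq (pchar0_natr_inj F0)) iota_uniq size_map size_iota.
  by rewrite -ltnNge => /(_ isT).
by exists t.
Qed.

(** On the moment curve v = (1, t, t^2, ...) each functional is a nonzero
    polynomial in t, so it suffices that t avoids the roots of their product. The
    positive dimension matters when m = 0: v must still be nonzero. *)
Lemma common_nonzero (F : fieldType) (n m : nat) (l : 'I_m -> 'rV[F]_n.+1) :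
  has_pchar0 F -> (forall i, l i != 0) ->
  exists2 v : 'cV[F]_n.+1, v != 0 & forall i, (l i *m v) 0 0 != 0.
Proof.
move=> F0 l0; pose P := \prod_i rVpoly (l i).
have P0 : P != 0.
  apply/prodf_neq0 => i _; apply: contraNneq (l0 i) => l_0.
  by rewrite -[l i]rVpolyK l_0 linear0.
have [t tP] := pchar0_nonroot F0 P0.
exists (\col_j t ^+ j).
  apply/eqP => /colP/(_ 0); rewrite !mxE expr0 => /eqP.
  by rewrite oner_eq0.
move=> i; move: tP; rewrite /root horner_prod => /prodf_neq0/(_ i isT).
congr (_ != _); rewrite (horner_coef_wide _ (size_poly _ _)) mxE.
by apply: eq_bigr => j _; rewrite coef_rVpoly_ord mxE.
Qed.

(** * Powers of linear forms *)

Section HyperplaneDiameter.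
Variables (F : fieldType).
Hypothesis F0 : has_pchar0 F.

(** The coefficient of x^(a-l) y^l in the sum on the right, where a = b + j, is the
    l-th moment of c times a binomial coefficient. The Vandermonde matrix at the
    nodes 0, ..., a is invertible, so c can be chosen with any prescribed moments;
    the binomial coefficient 'C(a, j) is then divided out. *)
Lemma monomial_sum_powers (b j : nat) :
  exists c : 'I_(b + j).+1 -> F, forall (A : comAlgType F) (x y : A),
    x ^+ b * y ^+ j = \sum_i c i *: (x + i%:R *: y) ^+ (b + j).
Proof.
set a := (b + j)%N.
pose V : 'M[F]_a.+1 := Vandermonde a.+1 (\row_i i%:R).
have V_unit : V \in unitmx.
  rewrite unitmxE det_Vandermonde unitfE; apply/prodf_neq0 => i _.
  apply/prodf_neq0 => l il; rewrite !mxE subr_eq0.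
  by rewrite (inj_eq (pchar0_natr_inj F0)) gtn_eqF.
have j_a : (j < a.+1)%N by rewrite ltnS leq_addl.
have C0 : 'C(a, j)%:R != 0 :> F.
  by rewrite ((pcharf0P F).1 F0) -lt0n bin_gt0 leq_addl.
pose c : 'cV_a.+1 := invmx V *m delta_mx (Ordinal j_a) 0.
have c_moment (l : 'I_a.+1) :
    \sum_(i < a.+1) (i%:R ^+ l) * c i 0 = (l == Ordinal j_a)%:R.
  have <- : (V *m c) l 0 = (l == Ordinal j_a)%:R.
    by rewrite mulmxA mulmxV // mul1mx !mxE andbT.
  by rewrite mxE; apply: eq_bigr => i _; rewrite !mxE.
exists (fun i => 'C(a, j)%:R^-1 * c i 0) => A x y.
under eq_bigr => i _ do rewrite exprDn scaler_sumr.
rewrite exchange_big (bigD1 (Ordinal j_a)) //= [X in _ + X]big1 => [|l /negbTE lj].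
  rewrite addr0.
  transitivity ((\sum_(i < a.+1) i%:R ^+ j * c i 0) *: (x ^+ b * y ^+ j)).
    by rewrite (c_moment (Ordinal j_a)) eqxx scale1r.
  rewrite scaler_suml; apply: eq_bigr => i _.
  rewrite exprZn addnK -scalerAr -scaler_nat !scalerA; congr (_ *: _).
  by field.
transitivity (('C(a, j)%:R^-1 * \sum_(i < a.+1) i%:R ^+ l * c i 0) *:
    (x ^+ (a - l) * y ^+ l *+ 'C(a, l))); last first.
  by rewrite c_moment lj mulr0 scale0r.
rewrite mulr_sumr scaler_suml; apply: eq_bigr => i _.
rewrite exprZn -scalerAr -!scaler_nat !scalerA; congr (_ *: _).
by ring.
Qed.

(** * Transvections: k + 1 translates suffice *)

Lemma det_transvection (n : nat) (i j : 'I_n) (t : F) :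
  i != j -> \det (1%:M + t *: delta_mx i j) = 1.
Proof.
suff below (i' j' : 'I_n) : (j' < i')%N -> \det (1%:M + t *: delta_mx i' j') = 1.
  rewrite -val_eqE neq_ltn => /orP[ij|/below //].
  by rewrite -det_tr linearD linearZ /= trmx1 trmx_delta below.
move=> ji; rewrite det_trig => [|].
  rewrite big1 // => l _; rewrite !mxE eqxx.
  case: (l =P i') => [->|]; rewrite ?mulr0 ?addr0 //=.
  by rewrite -val_eqE gtn_eqF // mulr0 addr0.
apply/is_trig_mxP => l l' ll'; rewrite !mxE.
case: (l =P l') => [ll|_]; first by rewrite ll ltnn in ll'.
case: (l =P i') => [li|_] /=; last by rewrite mulr0 addr0.
case: (l' =P j') => [lj|_] /=; last by rewrite mulr0 addr0.
by move: ll'; rewrite li lj ltnNge ltnW.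
Qed.

Lemma transvections_cover (n k : nat) (X : {vspace 'cV[F]_n}) :
  (1 < n)%N -> (\dim X).+1 = n ->
  translates_cover (SL_sympow F n k) (sympow_sub k X) k.+1.
Proof.
move=> n1 /hyperplane_coord[Q Q_unit [i0 XE]].
pose P := invmx Q.
have QP : Q *m P = 1%:M by rewrite mulmxV.
have [j0 ij] : exists j0, i0 != j0.
  have n0 := ltnW n1.
  case: (i0 =P Ordinal n0) => [->|/eqP]; last by exists (Ordinal n0).
  by exists (Ordinal n1).
(* In the basis of the columns e i of P, T t is the transvection that adds t times
   e i0, the basis vector outside X, to e j0 and fixes the other e i. *)
pose T (t : F) := P *m (1%:M + t *: delta_mx i0 j0) *m Q.
have T_det t : \det (T t) == 1.
  by rewrite !det_mulmx mulrAC -det_mulmx mulVmx // det1 mul1r det_transvection.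
pose e i : 'cV[F]_n := P *m delta_mx i 0.
have T_e t i : i != j0 -> T t *m e i = e i.
  move=> /negbTE i_j0; rewrite /T /e -mulmxA (mulmxA Q) QP mul1mx -mulmxA.
  congr (_ *m _).
  rewrite mulmxDl mul1mx -scalemxAl mul_delta_mx_cond eq_sym i_j0.
  by rewrite mulr0n scaler0 addr0.
have T_ej t : T t *m e j0 = e j0 + t *: e i0.
  rewrite /T /e -mulmxA (mulmxA Q) QP mul1mx -mulmxA.
  by rewrite mulmxDl mul1mx -scalemxAl mul_delta_mx mulmxDr -scalemxAr.
exists (fun i : 'I_k.+1 => SLMx (T_det i%:R)).
apply: (@symprod_basis_full _ _ _ P); first by rewrite unitmx_inv.
move=> f; rewrite -[fun i => _]/(fun i => e (f i)).
pose A := [set i | f i == i0]; pose B := [set i | f i == j0].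
have split_prod (h : 'I_k -> {mpoly F[n]}) u w :
    (forall i, f i = i0 -> h i = u) -> (forall i, f i = j0 -> h i = w) ->
    \prod_i h i = u ^+ #|A| * w ^+ #|B| *
      \prod_(i | (f i != i0) && (f i != j0)) h i.
  move=> hu hw.
  rewrite (bigID (mem A)) [X in _ * X = _](bigID (mem B)) /= -!mulrA.
  rewrite -[u ^+ _]prodr_const -[w ^+ _]prodr_const; congr (_ * (_ * _)).
  - by apply: eq_big => i /=; rewrite ?inE // => /eqP/hu.
  - apply: eq_big => [i|i /andP[_]]; last by rewrite inE => /eqP/hw.
    by rewrite !inE; case: eqP => // ->; rewrite (negbTE ij).
  by apply: eq_bigl => i; rewrite !inE.
(* The basis monomial with factors e (f i) is recovered from the translates of the
   product of the x i, in which e i0 has been replaced by e j0 to stay inside X. *)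
pose x i := e (if f i == i0 then j0 else f i).
have xX i : x i \in X.
  rewrite XE /x /e mulmxA QP mul1mx mxE andbT.
  by case: (f i =P i0) => [_|/eqP]; [rewrite (negbTE ij)|rewrite eq_sym => /negbTE->].
have [c cE] := monomial_sum_powers #|B| #|A|.
have AB_k : (#|B| + #|A| <= k)%N.
  rewrite -cardsUI (_ : B :&: A = set0) ?cards0 ?addn0.
    by rewrite -[X in (_ <= X)%N]card_ord max_card.
  apply/setP => i; rewrite !inE; case: eqP => // ->.
  by rewrite eq_sym (negbTE ij).
have -> : symprod (fun i => e (f i)) =
    \sum_(i < (#|B| + #|A|).+1) c i *: symprod (fun l => T i%:R *m x l).
  apply: val_inj; rewrite /= linear_sum /=.
  rewrite (split_prod _ (linform (e i0)) (linform (e j0))); try by move=> i ->.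
  rewrite [X in X * _]mulrC cE mulr_suml; apply: eq_bigr => i _.
  rewrite -scalerAl; congr (_ *: _).
  pose z := linform (e j0) + i%:R *: linform (e i0).
  rewrite [RHS](split_prod _ z z) => [|l fl|l fl].
  - rewrite -exprD [in RHS]addnC; congr (_ * _).
    apply: eq_bigr => l /andP[/negbTE l0 l1].
    by rewrite /x l0 T_e.
  - by rewrite /x fl eqxx T_ej linearD linearZ.
  - by rewrite /x fl eq_sym (negbTE ij) T_ej linearD linearZ.
apply: rpred_sum => i _; apply: rpredZ.
have i_k : (i < k.+1)%N by rewrite (leq_trans (ltn_ord i)).
apply: (subvP (sumv_sup (Ordinal i_k) _ (subvv _))) => //.
by rewrite /= -symmx_prod; apply/memv_img/sympow_sub_prod.
Qed.

(** * Derivatives: k translates do not suffice *)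

Lemma translates_cover_gt (n k m : nat) (X : {vspace 'cV[F]_n}) :
  (\dim X).+1 = n ->
  translates_cover (SL_sympow F n k) (sympow_sub k X) m -> (k < m)%N.
Proof.
case: n X => // n X /hyperplane_coord[Q Q_unit [i0 XE]] [g g_cover].
rewrite ltnNge; apply/negP => m_k.
(* The rows l i are the functionals whose kernels are the hyperplanes g i X. *)
pose l i := row i0 (Q *m invmx (g i)).
have l0 i : l i != 0.
  apply/eqP => li; have : l i *m (g i *m invmx Q) = 0 by rewrite li mul0mx.
  rewrite -row_mul -mulmxA mulKmx ?SL_unitmx // mulmxV // => /rowP/(_ i0).
  by rewrite !mxE eqxx => /eqP; rewrite oner_eq0.
have [v v0 lv] := common_nonzero F0 l0.
have : symprod (fun _ : 'I_k => v) \in fullv by rewrite memvf.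
rewrite -g_cover => /memv_sumP[q q_mem].
move/(congr1 (fun p : sympow F n.+1 k => dirders (codom l) p)).
rewrite /= prodr_const card_ord linear_sum /= [RHS]linear_sum big1 => [|i _].
  have l_size : size (codom l) = m by rewrite size_codom card_ord.
  rewrite dirdersXn l_size // => /eqP; apply/negP.
  rewrite scaler_eq0 mulf_eq0 !negb_or expf_neq0; last first.
    by rewrite (raddf_eq0 _ (@linform_inj _ _)).
  rewrite andbT ((pcharf0P F).1 F0) -lt0n ffact_gt0 m_k /=.
  by rewrite big_map big_enum; apply/prodf_neq0 => i _.
apply: (@dirders_mem0 _ _ (l i)); first exact: codom_f.
have /memv_imgP[r r_X ->] := q_mem i isT.
pose phi (p : sympow F n.+1 k) := dirder (l i) (symmx k (g i) p).
have phi_lin : linear phi by move=> c p p'; rewrite /phi !linearP.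
apply: (sympow_sub_eq0 phi_lin _ r_X) => x xX.
rewrite /phi symmx_prod; apply: dirder_prod => j.
rewrite -row_mul -mulmxA mulKmx ?SL_unitmx // mxE; apply/eqP.
by rewrite -XE.
Qed.

(** * Diameter and covering ratio *)

Lemma diam_hyperplane (n k : nat) (X : {vspace 'cV[F]_n}) :
  (1 < n)%N -> (\dim X).+1 = n ->
  diam (SL_sympow F n k) (sympow_sub k X) = k.+1.
Proof.
move=> n1 Xn; apply/diam_eqP => //; split; first exact: transvections_cover.
by move=> m; apply: translates_cover_gt.
Qed.

Lemma dim_ratio_hyperplane (n k : nat) (X : {vspace 'cV[F]_n}) :
  (1 < n)%N -> (\dim X).+1 = n ->
  (\dim {:sympow F n k})%:R / (\dim (sympow_sub k X))%:R =
    k%:R / (n%:R - 1) + 1 :> rat.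
Proof.
move=> n1 Xn; rewrite dimvf /dim /= dim_sympow_sub.
move: (\dim X) Xn n1 => d <-; rewrite ltnS => d0.
have := congr1 (fun i => i%:R : rat) (mul_bin_down (k + d) k).
rewrite addnS /= addKn.
have C0 : 'C((k + d).-1, k)%:R != 0 :> rat.
  rewrite pnatr_eq0 -lt0n bin_gt0 -ltnS prednK ?addn_gt0 ?d0 ?orbT //.
  by rewrite -addn1 leq_add2l.
have dR : d%:R != 0 :> rat by rewrite pnatr_eq0 -lt0n.
rewrite !natrM natrD -natr1 addrK => E.
apply: (mulfI dR); apply: (mulIf C0); rewrite mulrA mulfVK // -E.
by field.
Qed.

End HyperplaneDiameter.

Theorem proposition5p6 (R : realType) (n k : nat) (hn : (2 <= n)%N)
    (X : {vspace 'cV[R[i]]_n}) (hX : (\dim X).+1 = n) :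
  diam (SL_sympow R[i] n k) (sympow_sub k X) = k.+1 /\
  covering_ratio (SL_sympow R[i] n k) (sympow_sub k X) =
    (k%:R + 1) / (1 + (Num.ceil (k%:R / (n%:R - 1) : rat))%:~R) :> rat.
Proof.
have diamE := @diam_hyperplane _ (pchar_num R[i]) n k X hn hX.
split=> //; rewrite /covering_ratio diamE dim_ratio_hyperplane //.
by rewrite ceilDrz ?rpred1 // ceil1 intrD addrC natr1.
Qed.
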